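(* Let $d\ge1$, let $X$ be a separable complex Fréchet space and let $(T_a)_{a\in\mathbb R^d}$ be a strongly continuous operator group on $X$ with the Runge property. Then $\bigcap_{\lambda\in\mathbb C^*,\ a\in\mathbb R^d\setminus\{0\}}HC(\lambda T_a)$ is a residual subset of $X$.
   Context: An operator group $(T_a)_{a\in\mathbb R^d}$ on $X$ is a family of continuous linear operators on $X$ with $T_0=I$ and $T_{a+b}=T_aT_b$; it is strongly continuous if $a\mapsto T_af$ is continuous for each $f\in X$. For a continuous linear operator $T$, $HC(T)$ is the set of $x\in X$ such that $\{T^nx:\ n\ge0\}$ is dense in $X$. $\mathbb C^*=\mathbb C\setminus\{0\}$. The norm on $\mathbb R^d$ is the Euclidean norm. Runge property: for any continuous seminorm $\|\cdot\|$ on $X$ there exists $C>0$ such that, for any $N\ge1$, any $b_1,\dots,b_N\in\mathbb R^d$ with $\|b_i-b_j\|\ge C$ for $i\ne j$, any $g_1,\dots,g_N\in X$ and any $\varepsilon>0$, there exists $f\in X$ such that $\|T_{b_i}f-g_i\|<\varepsilon$ for each $i=1,\dots,N$. Residual means containing a dense $G_\delta$ subset. *)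

(* Defs.v *)
From HB Require Import structures.
From mathcomp Require Import all_boot all_order all_algebra.
From mathcomp.real_closed Require Import complex.
From mathcomp Require Import all_classical all_reals all_analysis borel_hierarchy.

Set Implicit Arguments.
Unset Strict Implicit.
Unset Printing Implicit Defensive.

Import Order.TTheory GRing.Theory Num.Theory.
Import numFieldNormedType.Exports.

Local Open Scope classical_set_scope.
Local Open Scope complex_scope.
Local Open Scope ring_scope.

(* [normc c] is the modulus of [c] as an element of [R]; the generic norm [`|c|]
   is valued in [R[i]]. *)
Definition seminorm (R : realType) (X : lmodType R[i]) (p : X -> R) : Prop :=
  [/\ forall x, 0 <= p x,
      forall x y, p (x + y) <= p x + p y &
      forall (c : R[i]) x, p (c *: x) = ComplexField.Normc.normc c * p x].

(* Local convexity follows from the second clause.  Completeness refers to the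
   seminorms and not to a [uniformType] structure, because the one carried by a
   [tvsType] is not required to be compatible with the addition. *)
Definition frechet_space (R : realType) (X : topologicalLmodType R[i]) : Prop :=
  exists p : nat -> X -> R,
    [/\ forall k, seminorm (p k),
        forall (x : X) (A : set X), nbhs x A <->
          exists (n : nat) (e : R), 0 < e /\
            [set y | forall k, (k <= n)%N -> p k (y - x) < e] `<=` A,
        forall x : X, (forall k, p k x = 0) -> x = 0 &
        forall u : nat -> X,
          (forall k (e : R), 0 < e -> exists N : nat, forall m n : nat,
             (N <= m)%N -> (N <= n)%N -> p k (u m - u n) < e) ->
          exists l : X, u @ \oo --> l].

Definition separable (X : topologicalType) : Prop :=
  exists D : set X, countable D /\ dense D.

(* The library norm on ['rV[R]_d] is the sup norm. *)
Definition euclidean_norm (R : realType) (d : nat) (a : 'rV[R]_d) : R :=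
  Num.sqrt (\sum_(i < d) a 0 i ^+ 2).

Definition operator_group (R : realType) (d : nat) (X : topologicalLmodType R[i])
    (T : 'rV[R]_d -> {linear X -> X}) : Prop :=
  [/\ forall a, continuous (T a),
      forall x, T 0 x = x &
      forall a b x, T (a + b) x = T a (T b x)].

Definition strongly_continuous (R : realType) (d : nat)
    (X : topologicalLmodType R[i]) (T : 'rV[R]_d -> {linear X -> X}) : Prop :=
  forall f : X, continuous (fun a => T a f).

Definition runge_property (R : realType) (d : nat)
    (X : topologicalLmodType R[i]) (T : 'rV[R]_d -> {linear X -> X}) : Prop :=
  forall p : X -> R, seminorm p -> continuous p ->
  exists C : R, 0 < C /\
    forall (N : nat) (b : 'I_N -> 'rV[R]_d) (g : 'I_N -> X) (e : R),
      (1 <= N)%N ->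
      (forall i j, i != j -> C <= euclidean_norm (b i - b j)) ->
      0 < e ->
      exists f : X, forall i, p (T (b i) f - g i) < e.

Definition HC (X : topologicalType) (T : X -> X) : set X :=
  [set x | dense (range (fun n : nat => iter n T x))].

Definition residual (X : topologicalType) (A : set X) : Prop :=
  exists G : set X, [/\ Gdelta G, dense G & G `<=` A].

(* Main.v *)
Require Import Defs.
From HB Require Import structures.
From mathcomp Require Import all_boot all_order all_algebra.
From mathcomp.real_closed Require Import complex.
From mathcomp Require Import all_classical all_reals all_analysis borel_hierarchy.
From mathcomp Require Import ring lra.

(** By Baire and separability it suffices that, for K a compact set of pairs
    (l, a) with l, a nonzero and U a ball around g, the vectors f such that every
    (l, a) in K satisfies l^n T_(na) f \in U for some n contain a dense open
    set.  If T_b f is close to nu^-1 g, then l^n T_(na) f is close to g as soon as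
    na is close to b and l^n close to nu; here closeness is uniform because the
    group is locally equicontinuous.  The Runge property provides f once there is
    a finite C-separated family of points b with weights nu such that every
    (l, a) in K meets some (b, nu) in this sense.

    Such a family is built for (l, a) near a fixed (l0, a0), arbitrarily far
    from the origin; compactness then gives it for K.  Let ell be a coordinate
    with ell(a0) > 0 and c = ln|l| / ell(a), so that |l^n| = exp(c ell(na)).
    At stage k only the values of c within O(1/k) of some c_k are handled, which is
    enough because the harmonic series diverges.  When (na)_n passes the
    height of stage k, round na to a grid of small mesh, whose cells are coloured so
    that equal colours are C-separated, and round the phase of l^n to a
    finite grid.  There are boundedly many pairs f = (colour, phase), and to each
    is assigned a delay s(f): since (l, a) is close to (l0, a0), after s(f) further
    steps the orbit is close to x + s(f) a0, with x the grid point, and its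
    phase has turned by that of l0^s(f).  These are the points b; different delays
    or stages put them at heights ell(b) more than C apart. *)

Set Implicit Arguments.
Unset Strict Implicit.
Unset Printing Implicit Defensive.

Import Order.TTheory GRing.Theory Num.Theory.
Import numFieldNormedType.Exports.

Local Open Scope classical_set_scope.
Local Open Scope complex_scope.
Local Open Scope ring_scope.

Local Notation normc := ComplexField.Normc.normc.

(** * Graded seminorms and Baire's theorem *)

Lemma ltr_normI (R : realType) (x e : R) : - e < x -> x < e -> `|x| < e.
Proof. by move=> h1 h2; rewrite ltr_norml h1. Qed.

Lemma ler_epsI (R : realType) (x y : R) :
  (forall e : R, 0 < e -> x <= y + e) -> x <= y.
Proof. by move=> h; apply/ler_addgt0Pr. Qed.

Lemma normc_ge0 (R : realType) (z : R[i]) : 0 <= normc z.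
Proof. by case: z => a b; exact: sqrtr_ge0. Qed.

Lemma normc0P (R : realType) (z : R[i]) : (normc z == 0) = (z == 0).
Proof.
apply/eqP/eqP => [|->]; first exact: ComplexField.Normc.eq0_normc.
exact: ComplexField.Normc.normc0.
Qed.

Lemma normc_gt0 (R : realType) (z : R[i]) : (0 < normc z) = (z != 0).
Proof. by rewrite lt_def normc0P normc_ge0 andbT. Qed.

Lemma normc_real (R : realType) (x : R) : normc x%:C = `|x|.
Proof. by rewrite /= expr0n addr0 sqrtr_sqr. Qed.

Lemma normcX (R : realType) (z : R[i]) n : normc (z ^+ n) = normc z ^+ n.
Proof.
elim: n => [|n IH]; first by rewrite !expr0; exact: ComplexField.Normc.normc1.
by rewrite !exprS ComplexField.Normc.normcM IH.
Qed.

Section Seminorm.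
Variables (R : realType) (X : topologicalLmodType R[i]) (p : X -> R).
Hypothesis sp : seminorm p.

Lemma seminorm0 : p 0 = 0.
Proof.
by case: sp => _ _ /(_ 0 0); rewrite scale0r ComplexField.Normc.normc0 mul0r.
Qed.

Lemma seminormN (x : X) : p (- x) = p x.
Proof.
case: sp => _ _ /(_ (-1) x).
by rewrite scaleN1r normcN ComplexField.Normc.normc1 mul1r.
Qed.

Lemma seminorm_distC (x y : X) : p (x - y) = p (y - x).
Proof. by rewrite -seminormN opprB. Qed.

Lemma seminorm_tri (z x y : X) : p (x - y) <= p (x - z) + p (z - y).
Proof. by rewrite -[x - y](subrKA z); case: sp. Qed.

End Seminorm.

(** As the seminorms increase, the balls of single seminorms already form a base of neighbourhoods;
    partial sums provide such a sequence. *)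
Definition graded (R : realType) (X : topologicalLmodType R[i])
    (q : nat -> X -> R) : Prop :=
  [/\ forall k, seminorm (q k),
      forall k (x : X), q k x <= q k.+1 x,
      forall (x : X) (A : set X), nbhs x A <->
        exists n (e : R), 0 < e /\ [set y | q n (y - x) < e] `<=` A &
      forall u : nat -> X,
        (forall k (e : R), 0 < e -> exists N : nat, forall m n : nat,
           (N <= m)%N -> (N <= n)%N -> q k (u m - u n) < e) ->
        exists l : X, u @ \oo --> l].

Lemma frechet_graded (R : realType) (X : topologicalLmodType R[i]) :
  frechet_space X -> exists q : nat -> X -> R, graded q.
Proof.
move=> [p [sp nbp _ cp]]; exists (fun k x => \sum_(i < k.+1) p i x).
have p_ge0 i x : 0 <= p i x by case: (sp i).
have le_sum k x i : (i <= k)%N -> p i x <= \sum_(i < k.+1) p i x.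
  move=> ik; rewrite -ltnS in ik; rewrite (bigD1 (Ordinal ik)) //=.
  by rewrite lerDl sumr_ge0.
split.
- move=> k; split.
  + by move=> x; exact: sumr_ge0.
  + move=> x y; rewrite -big_split /=; apply: ler_sum => i _.
    by case: (sp i).
  + move=> c x; rewrite mulr_sumr; apply: eq_bigr => i _.
    by case: (sp i).
- by move=> k x; rewrite [leRHS]big_ord_recr /= lerDl.
- move=> x A; rewrite nbp; split=> -[n [e [e0 sA]]].
  + exists n, e; split=> // y /= ye; apply: sA => k kn.
    exact: le_lt_trans (le_sum _ _ _ kn) ye.
  + exists n, (e / n.+1%:R); split; first by rewrite divr_gt0.
    move=> y /= ye; apply: sA => /=.
    have : \sum_(i < n.+1) p i (y - x) < \sum_(i < n.+1) (e / n.+1%:R).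
      apply: ltr_sum; first by apply/hasP; exists ord0; rewrite ?mem_index_enum.
      by move=> i _; apply: ye; rewrite -ltnS.
    by rewrite sumr_const card_ord -[ltRHS]mulr_natr divfK ?pnatr_eq0.
- move=> u cu; apply: cp => k e e0; have [N NP] := cu k e e0.
  exists N => m n mN nN.
  exact: le_lt_trans (le_sum _ _ _ (leqnn k)) (NP _ _ mN nN).
Qed.

Section Graded.
Variables (R : realType) (X : topologicalLmodType R[i]) (q : nat -> X -> R).
Hypothesis gq : graded q.

Let sq k : seminorm (q k). Proof. by case: gq. Qed.

Lemma graded_ge0 k (x : X) : 0 <= q k x. Proof. by case: (sq k). Qed.

Lemma graded_le k l (x : X) : (k <= l)%N -> q k x <= q l x.
Proof.
move=> /subnK <-; elim: (l - k)%N => [|n IH]; first by rewrite add0n.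
by apply: le_trans IH _; rewrite addSn; case: gq.
Qed.

Lemma graded_ball_nbhs k (x : X) (e : R) : 0 < e -> nbhs x [set y | q k (y - x) < e].
Proof. by move=> e0; case: gq => _ _ nq _; apply/nq; exists k, e; split. Qed.

Lemma graded_ball_open k (x : X) (e : R) : open [set y | q k (y - x) < e].
Proof.
rewrite openE => y /= ye; rewrite /interior.
have e0 : 0 < e - q k (y - x) by rewrite subr_gt0.
apply: filterS (graded_ball_nbhs k y e0) => z /=; rewrite ltrBrDr.
by apply: le_lt_trans; exact: seminorm_tri.
Qed.

Lemma graded_open (O : set X) (x : X) : open O -> O x ->
  exists n (e : R), 0 < e /\ [set y | q n (y - x) < e] `<=` O.
Proof.
by move=> oO Ox; case: gq => _ _ nq _; apply/nq; exact: open_nbhs_nbhs.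
Qed.

Lemma graded_continuous k : continuous (q k).
Proof.
have H (x y : X) (e : R) : q k (y - x) < e -> `|q k x - q k y| < e.
  have := seminorm_tri (sq k) y x 0; have := seminorm_tri (sq k) x y 0.
  rewrite !subr0 (seminorm_distC (sq k) x y) => h1 h2 h3.
  by apply: ltr_normI; lra.
move=> x; apply/cvgrPdist_lt => e e0.
by apply: filterS (graded_ball_nbhs k x e0) => y /H.
Qed.

Lemma graded_cvg_le (u : nat -> X) (l : X) k (x : X) (e : R) N : u @ \oo --> l ->
  (forall m, (N <= m)%N -> q k (u m - x) <= e) -> q k (l - x) <= e.
Proof.
move=> ul ue; apply: ler_epsI => eps eps0.
have [M _ MP] := ul _ (graded_ball_nbhs k l eps0).
have := MP (maxn M N) (leq_maxl _ _) => /=.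
have := ue (maxn M N) (leq_maxr _ _).
have := seminorm_tri (sq k) (u (maxn M N)) l x.
by rewrite (seminorm_distC (sq k) l (u _)); lra.
Qed.

Lemma graded_shrink (O : set X) (x : X) : open O -> O x -> forall j,
  exists n (e : R), [/\ 0 < e, e < j.+1%:R^-1, (j <= n)%N &
    [set y | q n (y - x) <= e] `<=` O].
Proof.
move=> oO Ox j; have [n [e [e0 sO]]] := graded_open oO Ox.
have j0 : 0 < j.+1%:R^-1 :> R by rewrite invr_gt0.
have [m [m0 me mj]] : exists m : R, [/\ 0 < m, m <= e & m <= j.+1%:R^-1].
  by exists (Num.min e j.+1%:R^-1); rewrite lt_min !ge_min e0 j0 !lexx orbT.
exists (maxn n j), (m / 2); split; [lra | | exact: leq_maxr | ].
  by apply: lt_le_trans mj; lra.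
move=> y /= ye; apply: sO => /=.
by have := graded_le (y - x) (leq_maxl n j); lra.
Qed.

(** Closed balls are nested so that the [j]-th has radius below [1/(j+1)] and belongs to a seminorm
    of index at least [j]. Hence the centres are Cauchy for every [q k], and their limit lies in all
    the balls. *)
Lemma graded_baire (O : nat -> set X) : (forall j, open (O j)) ->
  (forall j, dense (O j)) -> dense (\bigcap_j O j).
Proof.
move=> oO dO W [w Ww] oW.
pose B (s : X * nat * R) := [set y | q s.1.2 (y - s.1.1) < s.2].
pose cB (s : X * nat * R) := [set y | q s.1.2 (y - s.1.1) <= s.2].
have step (V : set X) j : open V -> V !=set0 -> exists s : X * nat * R,
    [/\ 0 < s.2, s.2 < j.+1%:R^-1, (j <= s.1.2)%N & cB s `<=` V `&` O j].
  move=> oV V0; have [x xVO] := dO j V V0 oV.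
  have [n [e eP]] := graded_shrink (openI oV (oO j)) xVO j.
  by exists (x, n, e).
pose P j s (s' : X * nat * R) := [/\ 0 < s'.2, s'.2 < j.+1%:R^-1,
  (j <= s'.1.2)%N & cB s' `<=` B s `&` O j].
have nextP (js : nat * (X * nat * R)) : 0 < js.2.2 -> exists s, P js.1 js.2 s.
  move=> s0; apply: step; first exact: graded_ball_open.
  by exists js.2.1.1; rewrite /B /= subrr (seminorm0 (sq _)).
have [s0 [s00 s01 s02 s03]] := step W 0%N oW (ex_intro _ w Ww).
(* The positivity of the radius stays inside the chosen statement, so that [f] is total; [s0] is a
   dummy value. *)
have /choice[f fP] (js : nat * (X * nat * R)) :
    exists s, 0 < js.2.2 -> P js.1 js.2 s.
  have [/nextP [s sP]|_] := ltP 0 js.2.2; first by exists s.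
  by exists s0.
pose t := fix t n := if n is m.+1 then f (m.+1, t m) else s0.
have tP n : [/\ 0 < (t n).2, (t n).2 < n.+1%:R^-1, (n <= (t n).1.2)%N &
    cB (t n) `<=` O n].
  elim: n => [|n [tn0 _ _ _]]; first by split=> // y /s03[].
  by have [a b c d] := fP (n.+1, t n) tn0; split=> // y /d[].
have tS n : cB (t n.+1) `<=` B (t n).
  have [tn0 _ _ _] := tP n.
  by have [_ _ _ d] := fP (n.+1, t n) tn0; move=> y /d[].
have cc n : (t n).1.1 \in cB (t n).
  by rewrite inE /cB /= subrr (seminorm0 (sq _)) ltW //; case: (tP n).
have sBc n : B (t n) `<=` cB (t n) by move=> y; exact: ltW.
have mono n m : (n <= m)%N -> cB (t m) `<=` cB (t n).
  move=> /subnK <-; elim: (m - n)%N => // k IH y ky.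
  by apply: IH; apply: sBc; exact: tS.
have inb n m : (n <= m)%N -> q (t n).1.2 ((t m).1.1 - (t n).1.1) <= (t n).2.
  by move=> nm; have := mono _ _ nm (t m).1.1; apply; rewrite -inE.
have [l ul] : exists l : X, (fun n => (t n).1.1) @ \oo --> l.
  case: gq => _ _ _; apply => k e e0.
  (* [N] makes the radius small, and the maximum with [k] makes the seminorm of that stage dominate
     [q k]. *)
  have [N _ NP] := near_infty_natSinv_lt (PosNum (divr_gt0 e0 (ltr0Sn R 1))).
  have Ne := NP (maxn N k) (leq_maxl _ _).
  exists (maxn N k) => m n mN nN.
  have [_ a b _] := tP (maxn N k).
  have kn := leq_trans (leq_maxr N k) b.
  apply: le_lt_trans (graded_le _ kn) _.
  apply: le_lt_trans (seminorm_tri (sq _) (t (maxn N k)).1.1 _ _) _.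
  rewrite (seminorm_distC (sq _) (t (maxn N k)).1.1).
  have := inb _ _ mN; have := inb _ _ nN.
  move: Ne a; rewrite /=; set h := (maxn N k).+1%:R^-1; lra.
have lP n : cB (t n) l by apply: (graded_cvg_le ul) => m; exact: inb.
exists l; split; first by have /s03[] := lP 0%N.
by move=> j _; have [_ _ _] := tP j; apply.
Qed.

End Graded.

(** * Local equicontinuity of the group *)

Section Operators.
Variables (R : realType) (d : nat) (X : topologicalLmodType R[i]).
Variables (T : 'rV[R]_d -> {linear X -> X}) (q : nat -> X -> R).
Hypotheses (gq : graded q) (oT : operator_group T) (cT : strongly_continuous T).

Let sq k : seminorm (q k). Proof. by case: gq. Qed.

(** One integer serves both as inverse radius and as bound, so that Baire's theorem can be applied
    to a sequence of sets. *)
Lemma orbit_bounded k (x : X) : exists j : nat,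
  forall h : 'rV[R]_d, `|h| < j.+1%:R^-1 :> R -> q k (T h x) <= j%:R.
Proof.
have nT : nbhs (T 0 x) [set y | q k (y - T 0 x) < 1] by exact: graded_ball_nbhs.
have /nbhs_normP[r /= r0 rP] := cT nT.
have [N _ NP] := near_infty_natSinv_lt (PosNum r0).
have [m mP] : exists m : nat, q k (T 0 x) + 1 <= m%:R.
  by exists (Num.truncn (q k (T 0 x) + 1)).+1; exact: ltW (truncnS_gt _).
exists (maxn N m) => h hr.
have : q k (T h x - T 0 x) < 1.
  apply: rP; rewrite /= sub0r normrN.
  by apply: lt_trans hr _; apply: NP => /=; exact: leq_maxl.
have := seminorm_tri (sq k) (T 0 x) (T h x) 0; rewrite !subr0.
have : m%:R <= (maxn N m)%:R :> R by rewrite ler_nat leq_maxr.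
lra.
Qed.

(** A uniform boundedness argument: by [orbit_bounded] the open sets [O j] cannot all be dense, so
    one of them misses a nonempty open set [W]. Translating a ball of [W] to 0 doubles the bound,
    and homogeneity scales it down to [e]. *)
Lemma local_equicontinuity k (e : R) : 0 < e -> exists l (r : R),
  0 < r /\   forall (h : 'rV[R]_d) (y : X), `|h| < r -> q l y < r -> q k (T h y) < e.
Proof.
move=> e0.
pose O j := [set x : X | exists2 h : 'rV[R]_d, `|h| < j.+1%:R^-1 :> R & j%:R < q k (T h x)].
have oO j : open (O j).
  rewrite openE => x [h hj jx]; rewrite /interior.
  have c : {for x, continuous (q k \o T h)}.
    have [cTh _ _] := oT.
    by apply: continuous_comp; [exact: cTh | exact: graded_continuous].
  have : nbhs (q k (T h x)) [set t | j%:R < t].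
    by apply: open_nbhs_nbhs; split=> //; exact: open_gt.
  move=> /c cy; have {}cy : nbhs x [set y | j%:R < q k (T h y)] by [].
  by apply: filterS cy => y /= yj; exists h.
have [j /existsNP[W /not_implyP[W0 /not_implyP[oW WO]]]] :
    exists j, ~ dense (O j).
  apply/existsNP => dO.
  have [|x [_ xO]] := graded_baire gq oO dO _ openT; first by exists 0.
  have [j jP] := orbit_bounded k x.
  by have [h /jP hj] := xO j Logic.I; rewrite ltNge hj.
case: W0 => x0 Wx0; have [l [r [r0 lW]]] := graded_open gq oW Wx0.
have j0 : 0 < j.+1%:R^-1 :> R by rewrite invr_gt0.
have bd (x : X) (h : 'rV[R]_d) : W x -> `|h| < j.+1%:R^-1 :> R -> q k (T h x) <= j%:R.
  move=> Wx hj; rewrite leNgt; apply/negP => jx; apply: WO.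
  by exists x; split=> //; exists h.
have bd2 (y : X) (h : 'rV[R]_d) : q l y < r -> `|h| < j.+1%:R^-1 :> R -> q k (T h y) <= j%:R + j%:R.
  move=> yr hj; rewrite -[y](addrK x0) linearB.
  have := seminorm_tri (sq k) 0 (T h (y + x0)) (T h x0).
  rewrite subr0 sub0r (seminormN (sq k)).
  have := bd _ _ Wx0 hj.
  have : q k (T h (y + x0)) <= j%:R.
    by apply: bd => //; apply: lW => /=; rewrite addrK.
  lra.
(* The summand 1 makes [M] positive and strictly larger than the bound [2j]. *)
pose M : R := j%:R + j%:R + 1; have M0 : 0 < M.
  by rewrite ltr_wpDl // addr_ge0.
have eM : 0 < e / M by rewrite divr_gt0.
have [m [m0 me mj]] : exists m : R, [/\ 0 < m, m <= r * (e / M) & m <= j.+1%:R^-1].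
  exists (Num.min (r * (e / M)) j.+1%:R^-1).
  by rewrite lt_min !ge_min mulr_gt0 // j0 !lexx orbT.
exists l, m; split=> // h y hm ym.
have zr : q l ((M / e)%:C *: y) < r.
  case: (sq l) => _ _ ->; rewrite normc_real gtr0_norm ?divr_gt0 //.
  by rewrite mulrC -ltr_pdivlMr ?divr_gt0 // invf_div; exact: lt_le_trans me.
have := bd2 _ _ zr (lt_le_trans hm mj).
rewrite linearZ; case: (sq k) => _ _ ->; rewrite normc_real gtr0_norm ?divr_gt0 //.
rewrite mulrAC ler_pdivrMr // => le1.
rewrite -(ltr_pM2l M0); apply: le_lt_trans le1 _.
by rewrite ltr_pM2r // /M ltrDl.
Qed.

(** The difference splits into [c T_h (w - g)], [c (T_h g - g)] and [(c - 1) g], controlled by local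
    equicontinuity, strong continuity and the smallness of [c - 1]. It will be used with
    [c = l^n / nu], [h = na - b] and [w = nu T_b f]. *)
Lemma joint_continuity k (g : X) (e : R) : 0 < e -> exists l (r : R),
  0 < r /\   forall (c : R[i]) (h : 'rV[R]_d) (w : X), normc (c - 1) < r -> `|h| < r -> q l (w - g) < r ->
    q k (c *: T h w - g) < e.
Proof.
move=> e0; have e80 : 0 < e / 8 by lra.
have [l [r [r0 rP]]] := local_equicontinuity k e80.
have nT : nbhs (T 0 g) [set y | q k (y - T 0 g) < e / 8].
  exact: graded_ball_nbhs.
have /nbhs_normP[s /= s0 sP] := cT nT.
have T0 : T 0 g = g by case: oT.
have D0 : 0 < q k g + 1 by rewrite ltr_wpDl ?graded_ge0.
pose t := e / 8 / (q k g + 1).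
have t0 : 0 < t by rewrite divr_gt0.
have [m [m0 mr ms mt m1]] : exists m : R, [/\ 0 < m, m <= r, m <= s, m <= t & m <= 1].
  exists (Num.min (Num.min r s) (Num.min t 1)).
  by rewrite !lt_min !ge_min r0 s0 t0 ltr01 !lexx !orbT.
exists l, m; split=> // c h w cm hm wm.
have -> : c *: T h w - g = c *: T h (w - g) + (c *: (T h g - g) + (c - 1) *: g).
  by rewrite linearB scalerBl scale1r !scalerBr !subrKA.
have c2 : normc c <= 2.
  rewrite -[c](subrK 1); apply: le_trans (le_normcD _ _) _.
  rewrite ComplexField.Normc.normc1; lra.
have c0 := normc_ge0 c.
have H1 : q k (T h (w - g)) < e / 8 by apply: rP; lra.
have H2 : q k (T h g - g) < e / 8.
  by rewrite -{2}T0; apply: sP; rewrite /= sub0r normrN; lra.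
have H3 : normc (c - 1) * q k g <= e / 8.
  have -> : e / 8 = t * (q k g + 1) by rewrite /t divfK // gt_eqF.
  have := graded_ge0 gq k g; have := normc_ge0 (c - 1); nra.
have [h1 h2 h3] := sq k.
apply: le_lt_trans (h2 _ _) _; rewrite h3.
have := h2 (c *: (T h g - g)) ((c - 1) *: g); rewrite !h3.
have := ler_wpM2r (h1 (T h (w - g))) c2; have := ler_wpM2r (h1 (T h g - g)) c2.
lra.
Qed.

End Operators.

(** * Rounding and sweeping lemmas *)

Lemma rV_coord_le (R : realType) (d : nat) (x : 'rV[R]_d) i : `|x 0 i| <= `|x|.
Proof.
rewrite [leRHS]mx_normrE.
by apply/bigmax_geP; right => /=; exists (0, i).
Qed.

Lemma rV_norm_le (R : realType) (d : nat) (x : 'rV[R]_d) (r : R) :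
  0 <= r -> (forall i, `|x 0 i| <= r) -> `|x| <= r.
Proof.
move=> r0 xr; rewrite [leLHS]mx_normrE; apply/bigmax_leP; split=> //.
by move=> [j i] _ /=; rewrite (ord1 j).
Qed.

Lemma series_harmonic_unbounded (R : realType) (A : R) :
  exists n, A < series harmonic n.
Proof.
apply: contrapT => nA; apply: (@dvg_harmonic R).
apply: nondecreasing_is_cvgn.
  by apply: nondecreasing_series => n _ _; exact: harmonic_ge0.
exists A => _ [n _ <-]; rewrite leNgt; apply/negP => An.
by apply: nA; exists n.
Qed.

(** The points [c k] start at [-A] for [k = k0] and advance by [rho / (k + 1)]. As the harmonic
    series diverges they pass [A], so [x] falls between two successive points. *)
Lemma harmonic_sweep (R : realType) (rho A : R) (k0 : nat) : 0 < rho ->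
  exists k1 (c : nat -> R), forall x : R, `|x| <= A ->
    exists k, [/\ (k0 <= k)%N, (k < k1)%N & `|x - c k| * k.+1%:R <= rho].
Proof.
move=> rho0; pose c k := - A + rho * (series harmonic k - series harmonic k0).
have [k1 k1P] := series_harmonic_unbounded (2 * A / rho + series harmonic k0).
exists k1, c => x xA.
have cS k : c k.+1 = c k + rho * k.+1%:R^-1.
  by rewrite /c /series /= big_nat_recr //=; ring.
have ck0 : c k0 <= x by move: xA; rewrite ler_norml /c => /andP[]; lra.
have xk1 : x < c k1.
  apply: (@le_lt_trans _ _ A); first by move: xA; rewrite ler_norml => /andP[].
  move: k1P; rewrite -ltrBrDr -(ltr_pM2l rho0) /c mulrCA divff ?gt_eqF // mulr1.
  lra.
have k01 : (k0 < k1)%N.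
  rewrite ltnNge; apply/negP => k10.
  have : c k1 <= c k0; last by lra.
  rewrite -(subnK k10); elim: (k0 - k1)%N => [|m IH]; first by rewrite add0n.
  rewrite addSn cS; apply: le_trans IH _; rewrite lerDl.
  by rewrite mulr_ge0 ?invr_ge0 // ltW.
have [k [k0k kk1 kx xk]] : exists k, [/\ (k0 <= k)%N, (k < k1)%N, c k <= x & x < c k.+1].
  move: xk1; rewrite -(subnK (ltnW k01)); elim: (k1 - k0)%N => [|m IH].
    by rewrite add0n => /(le_lt_trans ck0); rewrite ltxx.
  rewrite addSn => xm; have [xm'|mx] := ltP x (c (m + k0)%N).
    by have [k [? ? ? ?]] := IH xm'; exists k; split=> //; exact: ltnW.
  by exists (m + k0)%N; split=> //; exact: leq_addl.
exists k; split=> //; rewrite -ler_pdivlMr //.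
by rewrite ger0_norm ?subr_ge0 // lerBlDl -cS ltW.
Qed.

Lemma normc_distC (R : realType) (z w : R[i]) : normc (z - w) = normc (w - z).
Proof. by rewrite -normcN opprB. Qed.

Lemma near1_mul (R : realType) (z w : R[i]) (r s : R) :
  normc (z - 1) <= r -> normc (w - 1) <= s -> normc (z * w - 1) <= r + s + r * s.
Proof.
move=> zr ws; have -> : z * w - 1 = (z - 1) + (w - 1) + (z - 1) * (w - 1) by ring.
apply: le_trans (le_normcD _ _) _; rewrite ComplexField.Normc.normcM lerD //.
  by apply: le_trans (le_normcD _ _) _; rewrite lerD.
by apply: ler_pM; rewrite ?normc_ge0.
Qed.

Lemma near1_exp (R : realType) (S : nat) (r : R) : 0 < r ->
  exists t : R, 0 < t /\ forall (z : R[i]) s, normc (z - 1) < t -> (s <= S)%N ->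
    normc (z ^+ s - 1) <= r.
Proof.
elim: S r => [|S IH] r r0.
  exists 1; split=> // z s _; rewrite leqn0 => /eqP ->.
  by rewrite expr0 subrr ComplexField.Normc.normc0 ltW.
(* [3 * m] dominates [m + m + m * m], the error of a product given by [near1_mul]. *)
have [m [m0 m1 mr]] : exists m : R, [/\ 0 < m, m <= 1 & 3 * m <= r].
  by have [|] := leP 1 (r / 3) => ?; [exists 1|exists (r / 3)]; split; lra.
have [t [t0 tP]] := IH m m0.
have [u [u0 ut um]] : exists u : R, [/\ 0 < u, u <= t & u <= m].
  by exists (Num.min t m); rewrite lt_min !ge_min t0 m0 !lexx orbT.
exists u; split=> // z [|s] zu sS.
  by rewrite expr0 subrr ComplexField.Normc.normc0 ltW.
have zm : normc (z - 1) <= m by lra.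
have zt : normc (z - 1) < t by lra.
rewrite exprS; apply: le_trans (near1_mul zm (tP z s zt sS)) _; nra.
Qed.

Lemma expR_near1 (R : realType) (r : R) : 0 < r ->
  exists t : R, 0 < t /\ forall x : R, `|x| < t -> `|expR x - 1| <= r.
Proof.
move=> r0; have /cvgrPdist_lt /(_ r r0) := @continuous_expR R 0.
move=> /nbhs_normP[t /= t0 tP]; exists t; split=> // x xt.
have := tP x; rewrite /= sub0r normrN expR0 distrC => /(_ xt).
exact: ltW.
Qed.

Lemma small_pos (R : realType) (s : seq R) : all [pred x | 0 < x] s ->
  exists2 m : R, 0 < m & all [pred x | m <= x] s.
Proof.
elim: s => [|x s IH] /=; first by exists 1.
move=> /andP[x0 /IH[m m0 ms]]; exists (Num.min x m); first by rewrite lt_min x0.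
rewrite /= ge_min lexx /=; apply: sub_all ms => y /= my.
by rewrite ge_min my orbT.
Qed.

(** The residues of grid coordinates will be the colours. *)
Lemma modn_eq_dist (R : realType) (q v w : nat) : v != w -> v = w %[mod q] ->
  q%:R <= `|v%:R - w%:R| :> R.
Proof.
wlog lvw : v w / (v < w)%N => [H|_ /eqP e].
  case: ltngtP => // vw _ e; first by apply: H => //; rewrite ltn_eqF.
  by rewrite distrC; apply: H => //; rewrite ltn_eqF.
rewrite distrC -natrB ?(ltnW lvw) // normr_nat ler_nat dvdn_leq ?subn_gt0 //.
by rewrite -eqn_mod_dvd ?(ltnW lvw) // eq_sym.
Qed.

Lemma grid_round (R : realType) (eta x : R) (N : nat) : 0 < eta ->
  `|x| <= eta * N%:R -> exists v : 'I_(2 * N).+1,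
    `|x - eta * (v%:R - N%:R)| <= eta.
Proof.
move=> eta0 xN; pose y := x / eta + N%:R.
have xe : x = eta * (y - N%:R) by rewrite /y addrK mulrC divfK ?gt_eqF.
have [y0 yN] : 0 <= y /\ y <= (2 * N)%:R.
  move: xN; rewrite {1}xe normrM gtr0_norm // ler_pM2l // ler_norml natrM.
  by move=> /andP[]; split; lra.
have /andP[tr1 tr2] := truncn_itv y0.
have vN : (Num.truncn y < (2 * N).+1)%N by rewrite ltnS truncn_le_nat (le_lt_trans yN) ?ltr_nat.
exists (Ordinal vN) => /=; rewrite xe -mulrBr normrM gtr0_norm // ger_pMr //.
rewrite opprB addrA subrK ger0_norm; first by move: tr2; rewrite -natr1; lra.
lra.
Qed.

(** Real and imaginary parts are rounded separately, each with error at most [eta]. *)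
Lemma circle_round (R : realType) (eta : R) (N : nat) (u : R[i]) : 0 < eta ->
  1 <= eta * N%:R -> normc u = 1 -> exists g : 'I_(2 * N).+1 * 'I_(2 * N).+1,
    normc (u - ((eta * (g.1%:R - N%:R)) +i* (eta * (g.2%:R - N%:R)))) <= 2 * eta.
Proof.
case: u => x y eta0 N1 /= u1.
have xy1 : x ^+ 2 + y ^+ 2 = 1.
  by rewrite -[LHS]sqr_sqrtr ?u1 ?expr1n // addr_ge0 ?sqr_ge0.
have sq_le (z w : R) : z ^+ 2 + w ^+ 2 = 1 -> `|z| <= 1.
  by move=> zw; rewrite -(@expr_le1 _ 2) // real_normK ?num_real //; nra.
have [g1 g1P] := grid_round eta0 (le_trans (sq_le x y xy1) N1).
have yx1 : y ^+ 2 + x ^+ 2 = 1 by rewrite addrC.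
have [g2 g2P] := grid_round eta0 (le_trans (sq_le y x yx1) N1).
exists (g1, g2); rewrite /= -[leRHS]gtr0_norm ?mulr_gt0 // -sqrtr_sqr ler_wsqrtr //.
set a := x - _ in g1P *; set b := y - _ in g2P *.
have aP : a ^+ 2 <= eta ^+ 2 by rewrite -[a ^+ 2]real_normK ?num_real // lerXn2r ?nnegrE // ltW.
have bP : b ^+ 2 <= eta ^+ 2 by rewrite -[b ^+ 2]real_normK ?num_real // lerXn2r ?nnegrE // ltW.
rewrite exprMn; have := sqr_ge0 eta; lra.
Qed.

(** The bound [r <= 1] gives [|y| >= 1/2], so dividing by [y] at most doubles the error. *)
Lemma near1_div (R : realType) (u y : R[i]) (r : R) :
  0 < r -> r <= 1 -> normc u = 1 -> normc (u - y) <= r / 2 ->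
  y != 0 /\ normc (u / y - 1) <= r.
Proof.
move=> r0 r1 u1 uy.
have y2 : 1 / 2 <= normc y.
  have := le_normcD (u - y) y; rewrite subrK u1; lra.
have y0 : y != 0 by rewrite -normc_gt0; lra.
split=> //; have -> : u / y - 1 = (u - y) / y by rewrite mulrBl divff.
rewrite ComplexField.Normc.normcM ComplexField.Normc.normcV ler_pdivrMr ?normc_gt0 //.
nra.
Qed.

(** The constant comes from [(1 + r)^3 - 1 <= 7 r] on [[0, 1]]. *)
Lemma near1_mul3 (R : realType) (z w v : R[i]) (r : R) : r <= 1 ->
  normc (z - 1) <= r -> normc (w - 1) <= r -> normc (v - 1) <= r ->
  normc (z * w * v - 1) <= 7 * r.
Proof.
move=> r1 zr wr vr; have z0 := normc_ge0 (z - 1).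
by apply: le_trans (near1_mul (near1_mul zr wr) vr) _; nra.
Qed.

(** The factors isolate three errors: that of the modulus, with [a = |l|^n] and [b] its predicted
    value; that of the phase, rounded to [y]; and that of replacing [l] by [l0] during the delay
    [s]. *)
Lemma power_ratio_split (F : fieldType) (l l0 a b y : F) (n s : nat) :
  l0 != 0 -> a != 0 -> b != 0 -> y != 0 ->
  l ^+ (n + s) / (b * y * l0 ^+ s) = a / b * (l ^+ n / a / y) * (l / l0) ^+ s.
Proof.
move=> l00 a0 b0 y0; rewrite exprD expr_div_n.
have : l0 ^+ s != 0 by rewrite expf_neq0.
by move: (l ^+ n) (l ^+ s) (l0 ^+ s) => x z w w0; field; apply/and4P; split.
Qed.

(** * Separated families met by all orbits *)

Lemma archi_mul (R : realType) (x y : R) : 0 < y ->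
  exists n : nat, x <= n.+1%:R * y.
Proof.
by move=> y0; exists (Num.truncn (x / y)); rewrite -ler_pdivrMr // ltW ?truncnS_gt.
Qed.

Section Itineraries.
Variables (R : realType) (d : nat).
Implicit Types (s : seq ('rV[R]_d * R[i])) (C H e : R).

(* Separation in the sup norm of the library, hence also in the Euclidean one. *)
Definition well_spread C H s : bool :=
  all (fun p => H <= `|p.1|) s && pairwise (fun p p' => C <= `|p.1 - p'.1|) s.

(* An entry (b, nu) of [s] stands for the requirement that T_b f be close to
   nu^-1 g. *)
Definition visits e s (l : R[i]) (a : 'rV[R]_d) : Prop :=
  exists n p, [/\ p \in s, p.2 != 0, `|n%:R *: a - p.1| < e &
    normc (l ^+ n / p.2 - 1) < e].

(** The radius [k] is chosen before [H]: one neighbourhood is served by families arbitrarily far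
    out, which later allows families to be combined. *)
Lemma local_itinerary C e (l0 : R[i]) (a0 : 'rV[R]_d) :
  0 < C -> 0 < e -> l0 != 0 -> a0 != 0 ->
  exists2 k : R, 0 < k & forall H, exists2 s, well_spread C H s &
    forall l a, normc (l - l0) < k -> `|a - a0| < k -> visits e s l a.
Proof.
move=> C0 e0 l00 a00.
have [i0 ai0] : exists i0, a0 0 i0 != 0.
  apply/existsP; apply: contraNT a00; rewrite negb_exists => /forallP a00.
  by apply/eqP/rowP => i; rewrite mxE; apply/eqP; have := a00 i; rewrite negbK.
pose ell (x : 'rV[R]_d) := Num.sg (a0 0 i0) * x 0 i0.
have ellD (x y : 'rV[R]_d) : ell (x + y) = ell x + ell y by rewrite /ell mxE mulrDr.
have ellB (x y : 'rV[R]_d) : ell (x - y) = ell x - ell y by rewrite /ell !mxE mulrBr.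
have ellZ (r : R) (x : 'rV[R]_d) : ell (r *: x) = r * ell x by rewrite /ell mxE mulrCA.
have ell_le x : `|ell x| <= `|x|.
  by rewrite /ell normrM normr_sg ai0 mul1r rV_coord_le.
have [t0 t0E t00] : exists2 t0, ell a0 = t0 & 0 < t0.
  by exists (ell a0); rewrite // /ell -normrEsg normr_gt0.
have nl0 : 0 < normc l0 by rewrite normc_gt0.
(* [e1] is the error allowed to each factor of [power_ratio_split]; their product then has error at
   most [7 * e1 < e]. *)
have [e1 e10 /and3P[/= e1e e11 _]] :=
  @small_pos R [:: e / 8; 1] ltac:(by rewrite /= divr_gt0 //= ltr01).
have [t2 [t20 t2P]] := expR_near1 e10.
(* [L] bounds [|ln |l||] while [|l|] is within a factor 2 of [|l0|]; [A] bounds its quotient by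
   [ell a >= t0 / 2]. *)
pose L : R := `|ln (normc l0)| + ln 2.
have L0 : 0 < L by rewrite ltr_wpDl // ln_gt0 // ltr1n.
have [A A0 AP] : exists2 A : R, 0 < A & L <= A * (t0 / 2).
  by exists (L / (t0 / 2)); rewrite ?divr_gt0 ?divfK // gt_eqF ?divr_gt0.
(* The four bounds on the mesh serve, in order, the height, the position, the phase and the exponent
   of the modulus. *)
have [eta eta0 /and5P[/= etat etae eta1 etaA _]] :=
  @small_pos R [:: t0; e / 4; e1 / 4; t2 / 4 / A]
  ltac:(by rewrite /= t00 !divr_gt0 ?divr_gt0 ?ltr0n).
(* [q.+1] residues per coordinate keep distinct grid points of one colour [C] apart; [G] makes the
   phase grid cover the unit circle; delays will be multiples of [J]. *)
have [q qP] := archi_mul C eta0.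
have [G GP] : exists G : nat, 1 <= eta * G%:R.
  by have [G GP] := archi_mul 1 eta0; exists G.+1; rewrite mulrC.
have [J J0 JP] : exists2 J, (0 < J)%N & 4 * t0 + C <= J%:R * t0.
  by have [J JP] := archi_mul (4 * t0 + C) t00; exists J.+1.
pose F : finType := ({ffun 'I_d -> 'I_q.+1} * ('I_(2 * G).+1 * 'I_(2 * G).+1))%type.
(* [W] is the height reserved for one stage, enough for all [P] delays. *)
pose P := #|F|; pose S := (P * J)%N; pose W := S%:R * t0.
have P0 : (0 < P)%N by apply/card_gt0P; exists ([ffun=> ord0], (ord0, ord0)).
have WP : J%:R * t0 <= W.
  by rewrite /W ler_pM2r // ler_nat leq_pmull.
have W0 : 0 < W by lra.
have [t3 [t30 t3P]] := near1_exp S e10.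
have S0 : 0 < S%:R :> R by rewrite ltr0n muln_gt0 P0 J0.
(* [S] bounds the delays, so (l, a) may be replaced by (l0, a0) during a delay. *)
have [kap kap0 /and5P[/= kapl kapt kap1 kapS /andP[kapl0 _]]] :=
  @small_pos R [:: normc l0 / 2; t0 / 2; 1; e / 4 / S%:R; t3 * normc l0]
  ltac:(by rewrite /= !divr_gt0 ?divr_gt0 ?mulr_gt0 ?ltr01).
exists kap => // H.
have [k0 k0P] : exists k0 : nat, H + t0 <= k0%:R * W.
  by have [n nP] := archi_mul (H + t0) W0; exists n.+1.
(* With [rho = t2 / (3 W)], the error of [c k] costs at most [t2 / 3] in the exponent at heights up
   to [(k + 1) W]. *)
have [k1 [c cP]] := harmonic_sweep A k0 (divr_gt0 t20 (mulr_gt0 (ltr0Sn R 2) W0)).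
(* [B] bounds [|na|]: the first factors bound [n], since [ell a >= t0 / 2], and the last one bounds
   [|a|]. *)
pose B := (k1%:R * W + 2 * t0) / (t0 / 2) * (`|a0| + 1).
have [N NP] : exists N : nat, B <= eta * N%:R.
  by have [n nP] := archi_mul B eta0; exists n.+1; rewrite mulrC.
(* An index consists of a stage, a colour-phase pair and a grid point (shifted by
   [N] to have natural coordinates). *)
pose I : finType := ('I_k1 * F * {ffun 'I_d -> 'I_(2 * N).+1})%type.
pose pt (v : {ffun 'I_d -> 'I_(2 * N).+1}) : 'rV[R]_d :=
  \row_j (eta * ((v j)%:R - N%:R)).
pose sh (f : F) := (J * enum_rank f)%N.
pose ph (f : F) := ((eta * (f.2.1%:R - G%:R)) +i* (eta * (f.2.2%:R - G%:R))) : R[i].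
pose ctr (i : I) := pt i.2 + (sh i.1.2)%:R *: a0.
(* The phase grid contains 0, so some weights vanish; [visits] only counts nonzero ones. *)
pose wt (i : I) := (expR (c i.1.1 * ell (pt i.2)))%:C * ph i.1.2 * l0 ^+ sh i.1.2.
(* The orbit point has height between [k W] and [k W + 2 t0]; rounding it widens this window by at
   most [t0] on either side. *)
pose adm (i : I) := [&& (k0 <= i.1.1)%N, [forall j, (i.2 j %% q.+1 == i.1.2.1 j)%N],
  i.1.1%:R * W - t0 <= ell (pt i.2) & ell (pt i.2) <= i.1.1%:R * W + 3 * t0].
have ell_ctr (i : I) : ell (ctr i) = ell (pt i.2) + (sh i.1.2)%:R * t0.
  by rewrite /ctr ellD ellZ t0E.
exists [seq (ctr i, wt i) | i <- enum I & adm i].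
  apply/andP; split.
    apply/allP => _ /mapP[i + ->] /=; rewrite mem_filter => /andP[/and4P[k0i _ lo _] _].
    apply: le_trans (le_trans (ler_norm _) (ell_le _)); rewrite ell_ctr.
    have : 0 <= (sh i.1.2)%:R * t0 by rewrite mulr_ge0 // ltW.
    have : k0%:R * W <= i.1.1%:R * W by rewrite ler_pM2r // ler_nat.
    lra.
  (* [m] numbers the pairs (stage, delay).  Consecutive values are at heights at
     least 4 t0 + C apart, and admissible grid points fill a window of height 4 t0. *)
  pose m (i : I) := (i.1.1 * P + enum_rank i.1.2)%N.
  have mE (i : I) : i.1.1%:R * W + (sh i.1.2)%:R * t0 = (m i)%:R * (J%:R * t0).
    by rewrite /W /S /m /sh !natrD !natrM; ring.
  have lt_case (i j : I) : adm i -> adm j -> (m i < m j)%N -> C <= `|ctr i - ctr j|.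
    move=> /and4P[_ _ _ hi] /and4P[_ _ lo _] mij; rewrite distrC.
    apply: le_trans (le_trans (ler_norm _) (ell_le _)); rewrite ellB !ell_ctr.
    have : (m i).+1%:R * (J%:R * t0) <= (m j)%:R * (J%:R * t0).
      by rewrite ler_pM2r ?ler_nat //; lra.
    by rewrite -natr1 mulrDl mul1r -!mE; lra.
  rewrite pairwise_map.
  apply: (@sub_in_pairwise _ adm (fun i j : I => i != j)); last first.
  - by rewrite -uniq_pairwise filter_uniq // enum_uniq.
  - exact: filter_all.
  move=> i j ai aj /= ij; case: (ltngtP (m i) (m j)) => [||mij].
  - exact: lt_case.
  - by rewrite distrC; exact: lt_case.
  (* Stage and delay are quotient and remainder of [m] by [P], so here only the grid points differ,
     and they have the same colour. *)
  have rk (f : F) : (enum_rank f < P)%N by exact: ltn_ord.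
  have ek : i.1.1 = j.1.1 :> nat.
    by have := congr1 (divn^~ P) mij; rewrite /m !divnMDl // !divn_small // !addn0.
  have ef : i.1.2 = j.1.2.
    apply/enum_rank_inj/val_inj.
    by have := congr1 (modn^~ P) mij; rewrite /m !modnMDl !modn_small.
  have [w wij] : exists w, i.2 w != j.2 w.
    apply/existsP; apply: contraNT ij; rewrite negb_exists => /forallP e2.
    move: i j {ai aj mij} ek ef e2 => [[ki fi] vi] [[kj fj] vj] /= /val_inj -> -> e2.
    rewrite (_ : vi = vj) //; apply/ffunP => w; apply/eqP.
    by have := e2 w; rewrite negbK.
  apply: le_trans (rV_coord_le _ w); rewrite /ctr ef opprD addrACA subrr addr0.
  rewrite !mxE -mulrBr opprB addrA subrK normrM gtr0_norm //.
  move: ai aj => /and4P[_ /forallP/(_ w)/eqP ci _ _] /and4P[_ /forallP/(_ w)/eqP cj _ _].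
  have vw : (i.2 w : nat) != j.2 w by [].
  have qv : q.+1%:R <= `|(i.2 w)%:R - (j.2 w)%:R| :> R.
    by apply: modn_eq_dist => //; rewrite ci cj ef.
  by apply: le_trans qP _; rewrite mulrC ler_pM2l.
move=> l a la aa.
have ea : `|ell a - t0| <= kap.
  by rewrite -t0E -ellB; apply: le_trans (ell_le _) (ltW aa).
have [ea1 ea2] : t0 / 2 <= ell a /\ ell a <= 2 * t0.
  by move: ea; rewrite ler_norml => /andP[]; clear -kapt t00; split; lra.
have ea0 : 0 < ell a by clear -ea1 t00; lra.
have nl_le : normc l <= 2 * normc l0.
  by have := le_normcD (l - l0) l0; rewrite subrK; clear -la kapl nl0; lra.
have nl_ge : normc l0 / 2 <= normc l.
  by have := le_normcD (l0 - l) l; rewrite subrK normc_distC; clear -la kapl; lra.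
have nl1 : 0 < normc l by clear -nl_ge nl0; lra.
have lnL : `|ln (normc l)| <= L.
  have h1 : ln (normc l) <= ln 2 + ln (normc l0).
    by rewrite -lnM ?posrE // ler_ln ?posrE // mulr_gt0.
  have h2 : ln (normc l0) <= ln 2 + ln (normc l).
    by rewrite -lnM ?posrE // ler_ln ?posrE ?mulr_gt0 //; clear -nl_ge; lra.
  rewrite /L ler_norml; apply/andP.
  have := ler_norm (ln (normc l0)); have := ler_norm (- ln (normc l0)); rewrite normrN.
  by clear -h1 h2; split; lra.
pose x := ln (normc l) / ell a.
have xA : `|x| <= A.
  rewrite /x normrM normfV (gtr0_norm ea0) ler_pdivrMr //.
  by apply: le_trans lnL (le_trans AP _); rewrite ler_pM2l.
have [k [k0k kk1 ck]] := cP x xA.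
have kW0 : 0 <= k%:R * W by rewrite mulr_ge0 // ltW.
(* Each step raises the height by at most [2 t0], so the first [n] past [k W] overshoots by no more
   than that. *)
have [n n1 n2] : exists2 n : nat, k%:R * W <= n%:R * ell a &
    n%:R * ell a <= k%:R * W + 2 * t0.
  exists (Num.truncn (k%:R * W / ell a)).+1.
    by rewrite -ler_pdivrMr //; exact/ltW/truncnS_gt.
  have : (Num.truncn (k%:R * W / ell a))%:R * ell a <= k%:R * W.
    by rewrite -ler_pdivlMr // truncn_le divr_ge0 // ltW.
  by rewrite -natr1 mulrDl mul1r; clear -ea2; lra.
have naN j : `|(n%:R *: a) 0 j| <= eta * N%:R.
  apply: le_trans (rV_coord_le _ _) (le_trans _ NP); rewrite normrZ normr_nat.
  apply: ler_pM => //.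
    rewrite ler_pdivlMr ?divr_gt0 //.
    apply: (@le_trans _ _ (n%:R * ell a)); first by rewrite ler_wpM2l.
    by apply: le_trans n2 _; rewrite lerD2r ler_pM2r // ler_nat ltnW.
  by rewrite -[a](subrK a0); have := ler_normD (a - a0) a0; clear -aa kap1; lra.
have /fin_all_exists[v0 v0P] := fun j => grid_round eta0 (naN j).
pose v := [ffun j => v0 j].
have vP : `|n%:R *: a - pt v| <= eta.
  apply: rV_norm_le; first exact: ltW.
  by move=> j; have := v0P j; rewrite !mxE ffunE.
pose u := l ^+ n / (normc l ^+ n)%:C.
have nln0 : 0 < normc l ^+ n by rewrite exprn_gt0.
have u1 : normc u = 1.
  rewrite /u ComplexField.Normc.normcM ComplexField.Normc.normcV normc_real.
  by rewrite gtr0_norm // normcX divff // gt_eqF.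
have [g gP] := circle_round eta0 GP u1.
pose f : F := ([ffun j => inord (v j %% q.+1)], g).
pose i : I := (Ordinal kk1, f, v).
have ellv : `|ell (n%:R *: a) - ell (pt v)| <= eta.
  by rewrite -ellB; apply: le_trans (ell_le _) vP.
have [ellv1 ellv2] : - eta <= n%:R * ell a - ell (pt v) /\
    n%:R * ell a - ell (pt v) <= eta.
  by move: ellv; rewrite ellZ ler_norml => /andP[].
have lo : k%:R * W - t0 <= ell (pt v) by clear -ellv2 n1 etat; lra.
have hi : ell (pt v) <= k%:R * W + 3 * t0 by clear -ellv1 n2 etat; lra.
have admi : adm i.
  apply/and4P; split; [exact: k0k | | exact: lo | exact: hi].
  by apply/forallP => j; rewrite !ffunE inordK // ltn_mod.
have shS : (sh f <= S)%N.
  by rewrite /S /sh mulnC leq_mul2r ltnW ?ltn_ord ?orbT.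
have [y0 yP] : ph f != 0 /\ normc (u / ph f - 1) <= e1.
  by apply: near1_div => //; apply: le_trans gP _; clear -eta1; lra.
have wP : normc ((l / l0) ^+ sh f - 1) <= e1.
  apply: t3P => //; have -> : l / l0 - 1 = (l - l0) / l0 by rewrite mulrBl divff.
  rewrite ComplexField.Normc.normcM ComplexField.Normc.normcV ltr_pdivrMr //.
  exact: lt_le_trans la kapl0.
have mP : normc ((normc l ^+ n / expR (c k * ell (pt v)))%:C - 1) <= e1.
  rewrite (_ : _ - 1 = (normc l ^+ n / expR (c k * ell (pt v)) - 1)%:C); last first.
    by rewrite rmorphB.
  rewrite normc_real -expRN.
  have -> : normc l ^+ n = expR (x * (n%:R * ell a)).
    by rewrite mulrCA /x divfK ?gt_eqF // expRM_natl lnK ?posrE.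
  rewrite -expRD; apply: t2P.
  (* The first term is the rounding error, at most [A * eta]; the second is the error of the stage,
     where the height is at most [(k + 1) W] because [W >= 4 t0 + C]. *)
  have -> : x * (n%:R * ell a) - c k * ell (pt v) =
    x * (n%:R * ell a - ell (pt v)) + (x - c k) * ell (pt v) by ring.
  apply: le_lt_trans (ler_normD _ _) _; rewrite (normrM x) (normrM (x - c k)).
  have h1 : `|x| * `|n%:R * ell a - ell (pt v)| <= t2 / 4.
    rewrite -(divfK (lt0r_neq0 A0) (t2 / 4)) mulrC.
    by apply: ler_pM => //; apply: le_trans etaA; rewrite -ellZ.
  have h2 : `|x - c k| * `|ell (pt v)| <= t2 / 3.
    have pv : `|ell (pt v)| <= k.+1%:R * W.
      rewrite -natr1 mulrDl mul1r ler_norml; apply/andP.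
      by clear -lo hi kW0 W0 WP JP C0 t00; split; lra.
    apply: le_trans (ler_wpM2l (normr_ge0 _) pv) _.
    rewrite mulrA -(ler_pdivlMr _ _ W0); apply: le_trans ck _.
    by rewrite invfM mulrA.
  by apply: le_lt_trans (lerD h1 h2) _; clear -t20; lra.
exists (n + sh f)%N, (ctr i, wt i); split => /=.
- by apply: map_f; rewrite mem_filter admi mem_enum.
- rewrite !mulf_neq0 ?expf_neq0 // -normc0P normc_real normr_eq0 gt_eqF //.
  exact: expR_gt0.
(* The rounding error and the drift accumulated during the delay are each at most [e / 4]. *)
- rewrite /ctr /= natrD scalerDl opprD addrACA -scalerBr.
  apply: le_lt_trans (ler_normD _ _) _; rewrite normrZ normr_nat.
  have : (sh f)%:R * `|a - a0| <= S%:R * kap.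
    by apply: ler_pM => //; [rewrite ler_nat | exact: ltW].
  have : S%:R * kap <= e / 4 by rewrite mulrC -ler_pdivlMr.
  by clear -vP etae e0; lra.
rewrite /wt /=.
rewrite (@power_ratio_split _ l l0 (normc l ^+ n)%:C) //; first last.
- by rewrite -normc0P normc_real normr_eq0 gt_eqF // expR_gt0.
- by rewrite -normc0P normc_real normr_eq0 gt_eqF.
have e17 : 7 * e1 < e by clear -e0 e1e; lra.
apply: le_lt_trans (near1_mul3 e11 _ yP wP) e17.
by rewrite rmorphM fmorphV in mP.
Qed.

End Itineraries.

(** * From local families to compact sets of pairs *)

Section Catchable.
Variables (R : realType) (d : nat) (C e : R).
Hypotheses (C0 : 0 < C) (e0 : 0 < e).
Implicit Types K : set (R * R * 'rV[R]_d).

(** A pair [(l, a)] is stored as [(x, y, a)] with [l = x + iy], so that compactness is that of real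
    products. The free bound [H] makes the notion stable under unions. *)
Definition catchable K : Prop := forall H, exists2 s, well_spread C H s &
  forall x y a, K (x, y, a) -> visits e s (x +i* y) a.

Lemma catchableS K1 K2 : K1 `<=` K2 -> catchable K2 -> catchable K1.
Proof.
move=> K12 cK H; have [s sP sv] := cK H.
by exists s => // x y a /K12; exact: sv.
Qed.

Lemma catchable0 : catchable set0.
Proof. by move=> H; exists [::]. Qed.

(** If the first family lies within radius [B], the second is requested beyond [B + C], and the
    triangle inequality separates them. *)
Lemma catchableU K1 K2 : catchable K1 -> catchable K2 -> catchable (K1 `|` K2).
Proof.
move=> cK1 cK2 H; have [s1 /andP[H1 W1] v1] := cK1 H.
have [B BP] : exists B, forall p, p \in s1 -> `|p.1| <= B.
  exists (\sum_(p <- s1) `|p.1|) => p ps.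
  by rewrite (big_rem p) //= lerDl sumr_ge0.
have [s2 /andP[H2 W2] v2] := cK2 (Num.max H (B + C)).
exists (s1 ++ s2); last first.
  move=> x y a [/v1|/v2] [n [p [ps ? ? ?]]]; exists n, p; split=> //;
    by rewrite mem_cat ps ?orbT.
apply/andP; split.
  rewrite all_cat H1 /=; apply: sub_all H2 => p.
  by apply: le_trans; rewrite le_max lexx.
rewrite pairwise_cat W1 W2 !andbT; apply/allrelP => p p' ps ps'.
have := allP H2 _ ps'; rewrite ge_max => /andP[_ BC].
have := ler_normD (p'.1 - p.1) p.1; rewrite subrK distrC.
have := BP _ ps; lra.
Qed.

Lemma compact_catchable K : compact K ->
  (forall x y a, K (x, y, a) -> x +i* y != 0 /\ a != 0) -> catchable K.
Proof.
move=> cK K0; apply: contrapT => nK.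
(* Otherwise [F] is a proper filter, and a local family at a cluster point of [F]
   yields a contradiction. *)
pose F : set_system (R * R * 'rV[R]_d) := [set A | catchable (K `\` A)].
have FF : ProperFilter F.
  split; first by rewrite /F /= setD0.
  split.
  - by rewrite /F /= setDT; exact: catchable0.
  - move=> A B cA cB; have := catchableU cA cB; rewrite -setDIr; exact.
  - by move=> A B AB; apply: catchableS => p [Kp nB]; split=> // /AB.
have FK : F K by rewrite /F /= setDv; exact: catchable0.
have [[[x0 y0] a0] [/K0[l0 a00] cl]] := cK F FF FK.
have [k k0 kP] := local_itinerary C0 e0 l0 a00.
pose V := [set p : R * R * 'rV[R]_d |
  normc ((p.1.1 +i* p.1.2) - (x0 +i* y0)) < k /\ `|p.2 - a0| < k].
have nV : nbhs (x0, y0, a0) V.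
  have k20 : 0 < k / 2 by rewrite divr_gt0.
  apply: filterS (nbhsx_ballx (x0, y0, a0) _ k20) => -[[x y] a] [[/=]].
  rewrite -!ball_normE /= => hx hy ha; split; last by rewrite /= distrC; lra.
  have -> : (x +i* y) - (x0 +i* y0) = (x - x0)%:C + (0 +i* (y - y0)) by simpc.
  apply: le_lt_trans (le_normcD _ _) _; rewrite normc_real.
  rewrite /= expr0n add0r sqrtr_sqr distrC (distrC y); lra.
have FV : F (~` V).
  move=> H; have [s sP sv] := kP H; exists s => // x y a [_ /contrapT[]].
  exact: sv.
by have [p []] := cl _ _ FV nV.
Qed.

End Catchable.

(** * Density *)

Lemma normr_le_euclidean (R : realType) (d : nat) (a : 'rV[R]_d) :
  `|a| <= euclidean_norm a.
Proof.
apply: rV_norm_le => [|i]; first exact: sqrtr_ge0.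
rewrite -sqrtr_sqr ler_wsqrtr // (bigD1 i) //= lerDl sumr_ge0 // => j _.
exact: sqr_ge0.
Qed.

Lemma nbhs_all (T : topologicalType) (I : eqType) (s : seq I) (x : T)
    (A : I -> set T) : (forall i, i \in s -> nbhs x (A i)) ->
  nbhs x [set y | forall i, i \in s -> A i y].
Proof.
elim: s => [|i s IH] sA; first by apply: filterS (@filterT _ (nbhs x) _).
have h1 := sA i (mem_head _ _).
have h2 : nbhs x [set y | forall j, j \in s -> A j y].
  by apply: IH => j js; apply: sA; rewrite inE js orbT.
apply: filterS (filterI h1 h2) => y [yi ys] j.
by rewrite inE => /orP[/eqP ->|/ys].
Qed.

Section Density.
Variables (R : realType) (d : nat) (X : topologicalLmodType R[i]).
Variables (T : 'rV[R]_d -> {linear X -> X}) (q : nat -> X -> R).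
Hypotheses (gq : graded q) (oT : operator_group T) (cT : strongly_continuous T).
Hypothesis rT : runge_property T.

Let sq k : seminorm (q k). Proof. by case: gq. Qed.

Lemma runge_seq (p : X -> R) : seminorm p -> continuous p ->
  exists2 C : R, 0 < C & forall (s : seq ('rV[R]_d * X)) e,
    pairwise (fun t t' => C <= `|t.1 - t'.1|) s -> 0 < e ->
    exists f : X, forall t, t \in s -> p (T t.1 f - t.2) < e.
Proof.
move=> sp cp; have [C [C0 CP]] := rT sp cp; exists C => // s e.
case: s => [|t0 s] ps e0; first by exists 0.
have [||//|f fP] := CP (size (t0 :: s)) (fun i => (nth t0 (t0 :: s) i).1)
  (fun i => (nth t0 (t0 :: s) i).2) e.
- by [].
- have lt_case (i j : 'I_(size (t0 :: s))) : (i < j)%N ->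
      C <= `|(nth t0 (t0 :: s) i).1 - (nth t0 (t0 :: s) j).1|.
    by move=> ij; have /(pairwiseP t0) := ps; apply=> //; rewrite inE ltn_ord.
  move=> i j ij; apply: le_trans (normr_le_euclidean _).
  have : (i : nat) != j by [].
  by rewrite neq_ltn => /orP[/lt_case|/lt_case]; rewrite // distrC.
exists f => t ts; have it : (index t (t0 :: s) < size (t0 :: s))%N by rewrite index_mem.
by have := fP (Ordinal it); rewrite /= -/(nth t0 (t0 :: s) _) nth_index.
Qed.

Definition hit (K : set (R * R * 'rV[R]_d)) (U : set X) : set X :=
  [set f | forall x y a, K (x, y, a) ->
    exists n, U ((x +i* y) ^+ n *: T (n%:R *: a) f)].

(** The Runge property is applied with the extra value [w] at the origin, which gives density. The
    other conditions on [f] are finitely many and open, so they persist on a neighbourhood [V] of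
    [f]. *)
Lemma hit_dense (K : set (R * R * 'rV[R]_d)) k (z : X) (e : R) : compact K ->
  (forall x y a, K (x, y, a) -> x +i* y != 0 /\ a != 0) -> 0 < e ->
  dense (hit K [set y | q k (y - z) < e])°.
Proof.
move=> cK K0 e0 W [w Ww] oW.
have [m [r [r0 rW]]] := graded_open gq oW Ww.
have [l [r1 [r10 r1P]]] := joint_continuity gq oT cT k z e0.
pose p := q (maxn m l).
have [C C0 CP] := runge_seq (sq (maxn m l)) (graded_continuous gq (k := maxn m l)).
(* Taking [H = C] keeps the family [C] away from the origin. *)
have [s /andP[Hs Ws] sP] := compact_catchable C0 r10 cK K0 C.
(* [M] bounds the weights, which multiply the error when passing from [T_b f - nu^-1 z] to
   [nu T_b f - z]. A zero weight merely asks that [T_b f] be near 0. *)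
pose M := 1 + \sum_(t <- s) normc t.2.
have M0 : 0 < M by rewrite ltr_pwDl // sumr_ge0 // => t _; exact: normc_ge0.
have [rho rho0 /and3P[/= rhor rhoM _]] := @small_pos R [:: r; r1 / M]
  ltac:(by rewrite /= r0 divr_gt0).
have [|f fP] := CP ((0, w) :: [seq (t.1, t.2^-1 *: z) | t <- s]) rho _ rho0.
  rewrite /= pairwise_map Ws andbT all_map; apply: sub_all Hs => t /=.
  by rewrite sub0r normrN.
have T0 x : T 0 x = x by case: oT.
exists f; split.
  apply: rW => /=; have := fP (0, w) (mem_head _ _); rewrite /= T0.
  by have := graded_le gq (f - w) (leq_maxl m l); lra.
pose V := [set f' | forall t, t \in s -> p (T t.1 f' - t.2^-1 *: z) < rho].
have nV : nbhs f V.
  apply: nbhs_all => t ts.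
  have [ccT _ _] := oT.
  have nT : nbhs (T t.1 f) [set y | p (y - t.2^-1 *: z) < rho].
    apply: open_nbhs_nbhs; split; first exact: graded_ball_open.
    apply: (fP (t.1, t.2^-1 *: z)); rewrite inE; apply/orP; right.
    exact: (map_f (fun t => (t.1, t.2^-1 *: z)) ts).
  exact: (ccT t.1 f _ nT).
apply: filterS nV => f' f'V x y a Kxya.
have [n [[b nu] [/= bs nu0 hb hnu]]] := sP x y a Kxya.
exists n => /=.
(* The group law brings the orbit into the form treated by [joint_continuity]. *)
have -> : (x +i* y) ^+ n *: T (n%:R *: a) f' =
    ((x +i* y) ^+ n / nu) *: T (n%:R *: a - b) (nu *: T b f').
  rewrite linearZ scalerA divfK //; case: oT => _ _ <-.
  by rewrite subrK.
apply: r1P => //.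
apply: le_lt_trans (graded_le gq _ (leq_maxr m l)) _.
have -> : nu *: T b f' - z = nu *: (T b f' - nu^-1 *: z).
  by rewrite scalerBr scalerA divff // scale1r.
case: (sq (maxn m l)) => _ _ ->.
apply: (@lt_le_trans _ _ (normc nu * rho)).
  by rewrite ltr_pM2l ?normc_gt0 //; exact: (f'V (b, nu) bs).
apply: (@le_trans _ _ (M * rho)); last by rewrite mulrC -ler_pdivlMr.
rewrite ler_pM2r // /M (big_rem _ bs) /=.
have : 0 <= \sum_(t <- rem (b, nu) s) normc t.2.
  by rewrite sumr_ge0 // => t _; exact: normc_ge0.
lra.
Qed.

Lemma iter_scale_op (l : R[i]) (a : 'rV[R]_d) n (f : X) :
  iter n (fun x => l *: T a x) f = l ^+ n *: T (n%:R *: a) f.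
Proof.
case: oT => _ T0 TD; elim: n => [|n IH]; first by rewrite expr0 !scale1r scale0r T0.
by rewrite iterS IH linearZ scalerA -exprS -TD mulrS scalerDl scale1r.
Qed.

End Density.

(** * Compact exhaustion of the parameters, and conclusion *)

Definition annulus (R : realType) (d N : nat) : set (R * R * 'rV[R]_d) :=
  let B := `[- N.+1%:R, N.+1%:R]%classic : set R in
  (B `*` B `*` [set v : 'rV[R]_d | forall i, B (v 0 i)]) `&`
  [set p : R * R * 'rV[R]_d | N.+1%:R^-1 <= `|p.1.1| + `|p.1.2|] `&` [set p : R * R * 'rV[R]_d | N.+1%:R^-1 <= `|p.2|].

Lemma annulus_compact (R : realType) (d N : nat) : compact (@annulus R d N).
Proof.
pose B : set R := `[- N.+1%:R, N.+1%:R]%classic.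
pose E := B `*` B `*` [set v : 'rV[R]_d | forall i, B (v 0 i)].
have cB : compact B by exact: segment_compact.
have cE : compact E.
  apply: compact_setX; first exact: compact_setX.
  exact: (@rV_compact _ _ (fun=> B)).
have cl1 : closed [set p : R * R * 'rV[R]_d | N.+1%:R^-1 <= `|p.1.1| + `|p.1.2|].
  apply: (@closed_comp _ _ (fun p : R * R * 'rV[R]_d => `|p.1.1| + `|p.1.2|)
    [set x | N.+1%:R^-1 <= x]); last exact: closed_ge.
  move=> p _; apply: cvgD; apply: cvg_norm.
    by apply: (@cvg_comp _ _ _ fst fst); [exact: cvg_fst|exact: cvg_fst].
  by apply: (@cvg_comp _ _ _ fst snd); [exact: cvg_fst|exact: cvg_snd].
have cl2 : closed [set p : R * R * 'rV[R]_d | N.+1%:R^-1 <= `|p.2|].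
  apply: (@closed_comp _ _ (fun p : R * R * 'rV[R]_d => `|p.2|)
    [set x | N.+1%:R^-1 <= x]); last exact: closed_ge.
  by move=> p _; apply: cvg_norm; exact: cvg_snd.
rewrite /annulus -setIA; apply: compact_closedI => //; exact: closedI.
Qed.

Lemma annulus_neq0 (R : realType) (d N : nat) x y a :
  @annulus R d N (x, y, a) -> x +i* y != 0 /\ a != 0.
Proof.
have N0 : 0 < N.+1%:R^-1 :> R by rewrite invr_gt0.
move=> [[_ /= xy] /= aN]; split; last by rewrite -normr_gt0; exact: lt_le_trans aN.
apply/eqP => -[x0 y0]; move: xy; rewrite x0 y0 normr0 addr0.
by rewrite leNgt N0.
Qed.

(** [M] sums the norms and the inverses of the quantities to be bounded below, so one integer above
    it meets every condition. *)
Lemma annulus_cover (R : realType) (d : nat) x y a :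
  x +i* y != 0 :> R[i] -> a != 0 -> exists N, @annulus R d N (x, y, a).
Proof.
move=> xy0 a0.
have s0 : 0 < `|x| + `|y|.
  rewrite lt_def addr_ge0 // andbT paddr_eq0 // !normr_eq0.
  by apply: contra xy0 => /andP[/eqP -> /eqP ->].
have a00 : 0 < `|a| by rewrite normr_gt0.
pose M := `|x| + `|y| + `|a| + (`|x| + `|y|)^-1 + `|a|^-1.
have i1 : 0 < (`|x| + `|y|)^-1 by rewrite invr_gt0.
have i2 : 0 < `|a|^-1 by rewrite invr_gt0.
have [x0 y0] : 0 <= `|x| /\ 0 <= `|y| by [].
exists (Num.truncn M); have := truncnS_gt M; set n := (_ .+1)%:R => Mn.
have n0 : 0 < n by rewrite ltr0n.
have inB (t : R) : `|t| <= M -> (`[- n, n]%classic : set R) t.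
  move=> tM; rewrite /= in_itv /= -ler_norml; exact: le_trans tM (ltW Mn).
split; first split.
- split=> /=; first split.
  + by apply: inB; rewrite /M; lra.
  + by apply: inB; rewrite /M; lra.
  + by move=> i; apply: inB; apply: le_trans (rV_coord_le _ _) _; rewrite /M; lra.
- by rewrite /= -[leRHS]invrK lef_pV2 ?posrE //; rewrite /M in Mn; lra.
- by rewrite /= -[leRHS]invrK lef_pV2 ?posrE //; rewrite /M in Mn; lra.
Qed.

(** [g] inverts an injection of [D] into the naturals, with default value [x0] outside its image. *)
Lemma separable_seq (X : topologicalType) (x0 : X) : separable X ->
  exists g : nat -> X, forall O : set X, O !=set0 -> open O -> exists n, O (g n).
Proof.
move=> [D [/countable_injP[h hinj] dD]].
have /choice[g gP] n : exists z, (exists2 z', D z' & h z' = n) -> D z /\ h z = n.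
  have [[z Dz hz]|nz] := pselect (exists2 z', D z' & h z' = n); first by exists z.
  by exists x0.
exists g => O O0 oO; have [z [Oz Dz]] := dD O O0 oO.
have [Dg hg] := gP (h z) (ex_intro2 _ _ z Dz erefl).
exists (h z); suff -> : g (h z) = z by [].
by apply: hinj => //; rewrite inE.
Qed.

Theorem theorem6p3 (R : realType) (d : nat) (X : topologicalLmodType R[i])
    (T : 'rV[R]_d -> {linear X -> X}) :
  (1 <= d)%N ->
  frechet_space X ->
  separable X ->
  operator_group T ->
  strongly_continuous T ->
  runge_property T ->
  residual (\bigcap_(l in [set l : R[i] | l != 0])
            \bigcap_(a in [set a : 'rV[R]_d | a != 0])
              HC (fun x : X => l *: T a x)).
Proof.
move=> _ /frechet_graded[q gq] sX oT cT rT.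
have [g gP] := separable_seq 0 sX.
(* For [t = (i, k, m, N)] the target is the [q k]-ball of radius [1/(m+1)] around [g i], and the
   parameters range over the [N]-th compact set. *)
pose O (t : nat * nat * nat * nat) := (hit T (@annulus R d t.2)
  [set y | q t.1.1.2 (y - g t.1.1.1) < t.1.2.+1%:R^-1])°.
(* Numbers that code no quadruple give the whole space. *)
pose F j := if unpickle j is Some t then O t else setT.
have oF j : open (F j).
  by rewrite /F; case: unpickle => [t|]; [exact: open_interior | exact: openT].
have dF j : dense (F j).
  rewrite /F; case: unpickle => [t|]; last by move=> W W0 _; rewrite setIT.
  apply: (hit_dense gq oT cT rT).
  - exact: annulus_compact.
  - exact: annulus_neq0.
  - by rewrite invr_gt0.
exists (\bigcap_j F j); split; [by exists F | by have := graded_baire gq oF dF |].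
move=> f fF [x y] /= l0 a a0 U [u Uu] oU.
have [k [e [e0 eU]]] := graded_open gq oU Uu.
(* Half of [e] goes to the distance from [g i] to [u], half to the radius [1/(m+1)]. *)
have e20 : 0 < e / 2 by rewrite divr_gt0.
have [|i /= gi] := gP [set v | q k (v - u) < e / 2] _ (graded_ball_open gq _ _ _).
  by exists u; rewrite /= subrr seminorm0 //; case: gq.
have [m _ /(_ m (leqnn m)) mP] := near_infty_natSinv_lt (PosNum e20).
have [N KN] := annulus_cover l0 a0.
have := fF (pickle (i, k, m, N)) Logic.I; rewrite /F pickleK => /interior_subset.
move=> /(_ x y a KN)[n /= hn].
exists (iter n (fun v => (x +i* y) *: T a v) f); split; last by exists n.
apply: eU => /=; rewrite (iter_scale_op oT).
have [sq _ _ _] := gq.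
have := seminorm_tri (sq k) (g i) ((x +i* y) ^+ n *: T (n%:R *: a) f) u.
move=> tri; apply: le_lt_trans tri _; rewrite [e]splitr; apply: ltrD gi.
exact: lt_trans hn mP.
Qed.
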